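(* For $d\ge3$ let $J=J(d)$ denote the maximal number of lattice points that a $d$-dimensional reflexive simplex can have. Then for $d\ge3$: $$\frac{1}{3\,(d-2)!}\,t_{d-1}^2<J\le d+2t_{d-1}^2,$$ and $d+2t_{d-1}^2\in O\!\left(c^{2^{d+1}}\right)$ as $d\to\infty$, where $c\approx1.26408$ is the Vardi constant.
   Context: Let $M,N$ be dual lattices of rank $d$ with pairing $\langle\cdot,\cdot\rangle$, and $M_{\mathbb{R}}=M\otimes_{\mathbb Z}\mathbb{R}$, $N_{\mathbb{R}}=N\otimes_{\mathbb Z}\mathbb{R}$. A lattice polytope in $M_{\mathbb R}$ is a polytope whose vertices lie in $M$; its lattice points are its points in $M$. A reflexive polytope $P\subseteq M_{\mathbb R}$ is a $d$-dimensional lattice polytope containing the origin in its interior such that its dual polytope $P^*=\{x\in N_{\mathbb R}: \langle y,x\rangle\ge -1\ \forall y\in P\}$ is also a lattice polytope. A reflexive simplex is a reflexive polytope that is a simplex. Sylvester sequence: $y_0=2$, $y_n=1+y_0\cdots y_{n-1}$ for $n\ge1$; and $t_n=y_n-1$ for $n\ge 0$. The Vardi constant $c\approx 1.2640847353\cdots$ is the constant such that $y_n=\lfloor c^{2^{n+1}}+\tfrac12\rfloor$ for all $n\in\mathbb{N}$. *)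

(* Defs.v *)
From mathcomp Require Import all_boot all_order all_algebra.
From mathcomp Require Import all_classical all_reals all_analysis.

Set Implicit Arguments.
Unset Strict Implicit.
Unset Printing Implicit Defensive.

Import Order.TTheory GRing.Theory Num.Theory.
Import numFieldNormedType.Exports.

Local Open Scope classical_set_scope.
Local Open Scope card_scope.
Local Open Scope ring_scope.

(* The dual lattices M and N of rank d are identified with Z^d through dual
   bases: M_R and N_R both become 'rV[R]_d, the pairing is the standard one,
   and M, N are the integral vectors. *)

Definition pairing (R : realType) (d : nat) (y x : 'rV[R]_d) : R :=
  \sum_(i < d) y 0 i * x 0 i.

Definition lattice (R : realType) (d : nat) : set 'rV[R]_d :=
  [set x | forall i, x 0 i \is a Num.int].

Definition conv (R : realType) (d k : nat) (p : 'I_k -> 'rV[R]_d) :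
    set 'rV[R]_d :=
  [set x | exists w : 'I_k -> R,
     [/\ forall i, 0 <= w i, \sum_i w i = 1 & x = \sum_i w i *: p i]].

Definition affinely_independent (R : realType) (d k : nat)
    (p : 'I_k.+1 -> 'rV[R]_d) : Prop :=
  row_free (\matrix_(i < k) (p (lift ord0 i) - p ord0)).

Definition has_dim (R : realType) (d : nat) (P : set 'rV[R]_d) (k : nat) :
    Prop :=
  (exists p : 'I_k.+1 -> 'rV[R]_d,
     (forall i, P (p i)) /\ affinely_independent p) /\
  (forall p : 'I_k.+2 -> 'rV[R]_d,
     (forall i, P (p i)) -> ~ affinely_independent p).

Definition is_polytope (R : realType) (d : nat) (P : set 'rV[R]_d) : Prop :=
  exists (k : nat) (p : 'I_k -> 'rV[R]_d), P = conv p.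

Definition is_simplex (R : realType) (d : nat) (P : set 'rV[R]_d) : Prop :=
  exists (k : nat) (p : 'I_k.+1 -> 'rV[R]_d),
    affinely_independent p /\ P = conv p.

(* A vertex is a zero-dimensional face: v is the unique minimizer on P of some
   linear functional. *)
Definition is_vertex (R : realType) (d : nat) (P : set 'rV[R]_d)
    (v : 'rV[R]_d) : Prop :=
  P v /\ exists u : 'rV[R]_d,
    forall x, P x -> x <> v -> pairing v u < pairing x u.

Definition lattice_polytope (R : realType) (d : nat) (P : set 'rV[R]_d) :
    Prop :=
  is_polytope P /\ (forall v, is_vertex P v -> lattice v).

Definition dual_polytope (R : realType) (d : nat) (P : set 'rV[R]_d) : set 'rV[R]_d :=
  [set x | forall y, P y -> -1 <= pairing y x].

Definition reflexive_polytope (R : realType) (d : nat) (P : set 'rV[R]_d) :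
    Prop :=
  [/\ lattice_polytope P, has_dim P d, interior P 0
    & lattice_polytope (dual_polytope P)].

Definition reflexive_simplex (R : realType) (d : nat) (P : set 'rV[R]_d) :
    Prop :=
  reflexive_polytope P /\ is_simplex P.

Definition lattice_points (R : realType) (d : nat) (P : set 'rV[R]_d) :
    set 'rV[R]_d :=
  P `&` @lattice R d.

Definition is_max_lattice_points (R : realType) (d J : nat) : Prop :=
  (exists2 P : set 'rV[R]_d,
     reflexive_simplex P & lattice_points P #= `I_J) /\
  (forall P : set 'rV[R]_d,
     reflexive_simplex P -> lattice_points P #<= `I_J).

(* sylvester_prod n = y_0 * ... * y_(n-1); see sylvester_yE. *)
Fixpoint sylvester_prod (n : nat) : nat :=
  if n is m.+1 then (sylvester_prod m * (1 + sylvester_prod m))%N else 1%N.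

Definition sylvester_y (n : nat) : nat := (1 + sylvester_prod n)%N.

Definition sylvester_t (n : nat) : nat := (sylvester_y n - 1)%N.

Lemma sylvester_y0 : sylvester_y 0 = 2%N.
Proof. by []. Qed.

Lemma sylvester_yE (n : nat) :
  sylvester_y n = (1 + \prod_(i < n) sylvester_y i)%N.
Proof.
congr addn; elim: n => [|n IHn]; first by rewrite big_ord0.
by rewrite big_ord_recr /= -IHn.
Qed.

(* Positivity selects c among the two real numbers c and -c with this
   property. *)
Definition is_Vardi_constant (R : realType) (c : R) : Prop :=
  0 < c /\
  forall n : nat,
    (sylvester_y n)%:Z = Num.floor (c ^+ (2 ^ n.+1)%N + 1 / 2).

(* Main.v *)
Require Import Defs.
From mathcomp Require Import all_boot all_order all_algebra.
From mathcomp Require Import all_classical all_reals all_analysis.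
From mathcomp Require Import perm.
From mathcomp Require Import ring lra zify.

Set Implicit Arguments.
Unset Strict Implicit.
Unset Printing Implicit Defensive.

Import Order.TTheory GRing.Theory Num.Theory.
Import numFieldNormedType.Exports.

Local Open Scope classical_set_scope.
Local Open Scope ring_scope.
Local Open Scope card_scope.

(* Let v_i be the vertices of a reflexive d-simplex P and e_i those of its
   dual.  Then <v_j, e_i> = k_i [i = j] - 1 for positive integers k_i with
   sum 1/k_i = 1, and x |-> (1 + <x, e_i>)_i embeds the lattice points of P in
   the set of b in N^(d+1) with sum b_i/k_i = 1.  Forgetting the coordinate of
   the largest k_i, such a b either lies in the box b_i < k_i or is one of d
   multiples of unit vectors, so there are at most d + prod k_i of them, the
   product being over the d smallest k_i.  It is at most 2 t_(d-1)^2: by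
   Curtiss' theorem the sequence 1/k_i is majorised by the Sylvester unit
   fractions, and the logarithm is concave.
   For the lower bound take k = (y_0, .., y_(d-2), 2 t_(d-1), 2 t_(d-1)); there
   every b comes from a lattice point of a reflexive simplex.  The b with
   vanishing coordinates at y_0 = 2 and y_1 = 3 already outnumber the volume
   t_(d-1)^2 / (3 (d-2)!) of a (d-2)-dimensional simplex. *)

(** * Products of unit fractions with sum 1 *)

Lemma sylvester_tS n : sylvester_t n.+1 = (sylvester_t n * (sylvester_t n).+1)%N.
Proof. by rewrite /sylvester_t /sylvester_y !addKn. Qed.

Lemma sylvester_yT n : sylvester_y n = (sylvester_t n).+1.
Proof. by rewrite /sylvester_t /sylvester_y addKn. Qed.

Lemma sylvester_t_ge n : (n < sylvester_t n)%N.
Proof. by elim: n => [//|n IH]; rewrite sylvester_tS; nia. Qed.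

Lemma sylvester_t_gt0 n : (0 < sylvester_t n)%N.
Proof. exact: leq_trans (sylvester_t_ge n). Qed.

Section EgyptianFractions.
Context {R : realFieldType}.
Implicit Types (x s : nat -> R) (a : nat -> nat).

Lemma sylvester_prodE n :
  \prod_(i < n) ((sylvester_y i)%:R : R)^-1 = (sylvester_t n)%:R^-1.
Proof.
elim: n => [|n IH]; first by rewrite big_ord0 invr1.
by rewrite big_ord_recr /= IH sylvester_tS sylvester_yT natrM invfM.
Qed.

(** Telescoping: [1/y_i = 1/t_i - 1/t_(i+1)], because [t_(i+1) = t_i * y_i] and [y_i = t_i + 1]. *)
Lemma sylvester_sumE n :
  \sum_(i < n) ((sylvester_y i)%:R : R)^-1 = 1 - (sylvester_t n)%:R^-1.
Proof.
elim: n => [|n IH]; first by rewrite big_ord0 invr1 subrr.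
have := sylvester_t_gt0 n; rewrite -(ltr_nat R) => t0.
rewrite big_ord_recr /= IH sylvester_tS sylvester_yT natrM -natr1.
by field; rewrite !gt_eqF ?ltr_wpDr.
Qed.

(* The majorisation (Karamata) inequality for the logarithm, in multiplicative
   form: AM-GM reduces it to [\sum_i s i / x i <= n], which is Abel summation. *)
Lemma prod_le_of_majorized n x s :
  (forall i, (i < n)%N -> 0 < x i) -> (forall i, (i < n)%N -> 0 <= s i) ->
  (forall i, (i.+1 < n)%N -> x i.+1 <= x i) ->
  (forall j, (j < n)%N -> \sum_(i < j) x i <= \sum_(i < j) s i) ->
  \sum_(i < n) s i <= \sum_(i < n) x i ->
  \prod_(i < n) s i <= \prod_(i < n) x i.
Proof.
move=> x0 s0 xdec maj tot.
case: n => [|n] in x0 s0 xdec maj tot *; first by rewrite !big_ord0.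
(* Abel summation as an invariant: while the prefix sums of [s] dominate those of [x], replacing
   [/ x j] by the larger [/ x j.+1] only weakens the bound. At the last index the numerator is
   nonpositive. *)
have abel j : (j < n.+1)%N -> \sum_(i < j.+1) (s i / x i - 1) <=
    (\sum_(i < j.+1) s i - \sum_(i < j.+1) x i) / x j.
  elim: j => [|j IH] jn.
    by rewrite !big_ord1 mulrBl divff // gt_eqF // x0.
  rewrite big_ord_recr /= [\sum_(i < j.+2) s i]big_ord_recr.
  rewrite [\sum_(i < j.+2) x i]big_ord_recr /=.
  have := IH (ltnW jn); have := maj _ jn; have := xdec _ jn.
  have := x0 _ jn; have := x0 _ (ltnW jn).
  set S := \sum_(i < _) s i; set X := \sum_(i < _) x i; set A := \sum_(i < _) _.
  move=> p q le XS le1.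
  have : (S - X) / x j <= (S - X) / x j.+1.
    by rewrite ler_wpM2l ?subr_ge0 // lef_pV2.
  have -> : (S + s j.+1 - (X + x j.+1)) / x j.+1 =
    (S - X) / x j.+1 + (s j.+1 / x j.+1 - 1) by field; rewrite gt_eqF.
  lra.
have le_sum : \sum_(i < n.+1) (s i / x i) <= n.+1%:R.
  have := abel n (ltnSn n); rewrite sumrB sumr_const card_ord => /le_trans h.
  rewrite -subr_le0; apply: h.
  by rewrite pmulr_lle0 ?invr_gt0 ?x0 // subr_le0.
have px : 0 < \prod_(i < n.+1) x i by apply: prodr_gt0 => i _; apply: x0.
have q0 (i : 'I_n.+1) : 0 <= s i / x i by rewrite divr_ge0 ?s0 ?ltW ?x0.
have [] := @leif_AGM R _ [set: 'I_n.+1]%SET (fun i => s i / x i).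
  by move=> i _; apply: q0.
rewrite cardsT card_ord (eq_bigl predT); last by move=> i; rewrite inE.
rewrite [in leRHS](eq_bigl predT); last by move=> i; rewrite inE.
rewrite big_split /= prodfV => agm _.
have -> : \prod_(i < n.+1) s i =
    (\prod_(i < n.+1) s i / \prod_(i < n.+1) x i) * \prod_(i < n.+1) x i.
  by rewrite divfK // gt_eqF.
rewrite ler_piMl ?(ltW px) //; apply: le_trans agm _.
rewrite exprn_ile1 ?divr_ge0 ?sumr_ge0 //.
by rewrite ler_pdivrMr ?ltr0n // mul1r.
Qed.

(** The product of the [a i] is a common denominator, so the gap to 1 is an integer multiple of its
    inverse, and a positive one. *)
Lemma unit_fraction_gap a m :
  (forall i, (i < m)%N -> (0 < a i)%N) ->
  \sum_(i < m) ((a i)%:R : R)^-1 < 1 ->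
  \prod_(i < m) ((a i)%:R : R)^-1 <= 1 - \sum_(i < m) ((a i)%:R : R)^-1.
Proof.
move=> a0.
have [z zE] : exists z : int,
    1 - \sum_(i < m) ((a i)%:R : R)^-1 = z%:~R * \prod_(i < m) ((a i)%:R : R)^-1.
  elim: m a0 => [|m IH] a0.
    by exists 1; rewrite !big_ord0 subr0 mulr1.
  have [i im|z zE] := IH; first by apply: a0; apply: ltnW.
  exists (z * (a m)%:Z - (\prod_(i < m) (a i))%N%:Z).
  rewrite !big_ord_recr /= opprD addrA zE rmorphB rmorphM /= -!pmulrn.
  rewrite natr_prod.
  have am : (a m)%:R != 0 :> R by rewrite pnatr_eq0 -lt0n a0.
  have : \prod_(i < m) ((a i)%:R : R) != 0.
    by apply/prodf_neq0 => i _; rewrite pnatr_eq0 -lt0n a0 // ltnS ltnW.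
  by rewrite prodfV => pn; field; rewrite am.
move=> lt1; have : 0 < 1 - \sum_(i < m) ((a i)%:R : R)^-1 by rewrite subr_gt0.
rewrite zE => h.
have p0 : 0 < \prod_(i < m) ((a i)%:R : R)^-1.
  by apply: prodr_gt0 => i _; rewrite invr_gt0 ltr0n a0.
move: h; rewrite pmulr_lgt0 // ltr0z => z0.
by rewrite ler_peMl ?(ltW p0) // -[leLHS]/(1%:~R) ler_int -gtz0_ge1.
Qed.

(* Curtiss' theorem on the best approximation of 1 from below by unit
   fractions. *)
Lemma curtiss a m :
  (forall i, (i < m)%N -> (0 < a i)%N) ->
  (forall i, (i.+1 < m)%N -> (a i <= a i.+1)%N) ->
  \sum_(i < m) ((a i)%:R : R)^-1 < 1 ->
  \sum_(i < m) ((a i)%:R : R)^-1 <= 1 - (sylvester_t m)%:R^-1.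
Proof.
have [n] := ubnP m; elim: n m => // n IH m /ltnSE mn a0 amon lt1.
(* If the sum reaches the Sylvester sum, then together with the induction hypothesis on proper
   prefixes this is majorisation. Hence [\prod 1 / a i >= 1 / t_m], and the gap is at least that
   product. *)
have [//|le2] := orP (le_total (\sum_(i < m) ((a i)%:R : R)^-1) (1 - (sylvester_t m)%:R^-1)).
have := unit_fraction_gap a0 lt1.
suff h : (sylvester_t m)%:R^-1 <= \prod_(i < m) ((a i)%:R : R)^-1.
  by move=> ?; lra.
rewrite -[leLHS]sylvester_prodE.
apply: (@prod_le_of_majorized m (fun i => (a i)%:R^-1)
  (fun i => (sylvester_y i)%:R^-1)).
- by move=> i im; rewrite invr_gt0 ltr0n a0.
- by move=> i im; rewrite invr_ge0 ler0n.
- move=> i im; rewrite lef_pV2 ?ler_nat ?amon // posrE ltr0n a0 //; exact: ltnW.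
- move=> j jm; rewrite sylvester_sumE; apply: IH.
  + exact: leq_trans mn.
  + by move=> i ij; apply: a0; apply: ltn_trans jm.
  + by move=> i ij; apply: amon; apply: ltn_trans jm.
  + apply: le_lt_trans lt1.
    rewrite -(subnKC (ltnW jm)) big_split_ord /= lerDl.
    by apply: sumr_ge0 => i _; rewrite invr_ge0.
- by rewrite sylvester_sumE.
Qed.


(** The summand is [x] with [r] inserted at position [j]. An arbitrary commutative law serves both
    the sums and the product in the majorisation below. *)
Lemma big_insert (T : Type) (idx : T) (op : Monoid.com_law idx)
    (x : nat -> T) (r : T) (j l : nat) :
  \big[op/idx]_(i < l)
    (if (i < j)%N then x i else if i == j :> nat then r else x i.-1) =
  if (l <= j)%N then \big[op/idx]_(i < l) x i
  else op (\big[op/idx]_(i < l.-1) x i) r.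
Proof.
elim: l => [|l IH]; first by rewrite !big_ord0.
rewrite big_ord_recr IH /=; case: (ltngtP l j) => [lj|jl|->].
- by rewrite big_ord_recr.
- by case: l jl {IH} => // l jl; rewrite [in RHS]big_ord_recr /= Monoid.mulmAC.
- by [].
Qed.

(* With [m = d - 1] and [r = 1 - \sum_(i < m) 1 / a i = 1 / a m + 1 / a m.+1],
   monotonicity gives [a m <= 2 / r], so that it suffices to bound
   [(\prod_(i < m) a i) / r] by [t_m ^ 2].  This is majorisation of the
   sequence [1 / a i], [i < m], with [r] inserted at its rank [j], by the
   sequence [1 / y_0, .., 1 / y_(m-1), 1 / t_m]. *)
Lemma prod_unit_fractions_le a d :
  (3 <= d)%N ->
  (forall i, (i <= d)%N -> (0 < a i)%N) ->
  (forall i, (i < d)%N -> (a i <= a i.+1)%N) ->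
  \sum_(i < d.+1) ((a i)%:R : R)^-1 = 1 ->
  (\prod_(i < d) a i <= 2 * sylvester_t (d - 1) ^ 2)%N.
Proof.
case: d => // m; rewrite ltnS subn1 /= => m2 a0 amon sum1.
pose x i : R := (a i)%:R^-1.
have x0 i : (i <= m.+1)%N -> 0 < x i by move=> /a0; rewrite invr_gt0 ltr0n.
have xdec i : (i <= m)%N -> x i.+1 <= x i.
  by move=> im; rewrite lef_pV2 ?ler_nat ?amon // posrE ltr0n a0 // ltnW.
have xle i l : (i <= l)%N -> (l <= m.+1)%N -> x l <= x i.
  elim: l => [|l IH]; first by rewrite leqn0 => /eqP ->.
  rewrite leq_eqVlt => /predU1P[->//|il] lm.
  by apply: le_trans (IH _ _); rewrite ?xdec // ltnW.
pose X l := \sum_(i < l) x i; pose r := 1 - X m.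
have rE : r = x m + x m.+1.
  by rewrite /r -sum1 !big_ord_recr /= -/(X m) /x; ring.
have r0 : 0 < r by rewrite rE addr_gt0 ?x0.
have rm : r <= 2 * x m by rewrite rE; have := xdec m (leqnn m); lra.
have Xlt l : (l <= m)%N -> X l <= 1 - (sylvester_t l)%:R^-1.
  move=> lm; apply: curtiss.
  - by move=> i il; apply: a0; rewrite (leq_trans (ltnW il)) // ltnW.
  - by move=> i il; apply: amon; lia.
  - apply: (@lt_le_trans _ _ (\sum_(i < l.+1) ((a i)%:R : R)^-1)).
      by rewrite big_ord_recr /= ltrDl; apply: x0; rewrite (leq_trans lm).
    rewrite -[leRHS]sum1 -(subnKC (_ : l.+1 <= m.+2)%N); last lia.
    rewrite [leRHS]big_split_ord /= lerDl; apply: sumr_ge0 => i _.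
    by rewrite invr_ge0.
have Xtail l : (l <= m)%N -> X l + x m <= X l.+1.
  by move=> lm; rewrite /X big_ord_recr lerD2l xle //; lia.
have tE l : (sylvester_t l.+1)%:R = (sylvester_t l)%:R * ((sylvester_t l)%:R + 1) :> R.
  by rewrite sylvester_tS natrM -natr1.
have t0 l : 1 <= (sylvester_t l)%:R :> R by rewrite ler1n sylvester_t_gt0.
have Xmon l l' : (l <= l')%N -> (l' <= m)%N -> X l <= X l'.
  move=> ll l'm; rewrite -(subnKC ll) /X big_split_ord /= lerDl.
  by apply: sumr_ge0 => i _; rewrite invr_ge0.
(* The rank of [r]: the first index below [m] with [x j <= r], or [m] if there is none. *)
have [j jP jmin] := @ex_minnP (fun i => (i == m) || (x i <= r))
  (ex_intro _ m (introT orP (or_introl (eqxx m)))).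
have jm : (j <= m)%N by apply: jmin; rewrite eqxx.
have xj i : (i < j)%N -> r <= x i.
  move=> ij; rewrite leNgt; apply: contraTN ij => /ltW xr.
  by rewrite -leqNgt jmin // xr orbT.
have jx i : (j <= i)%N -> (i < m)%N -> x i <= r.
  move=> ji im; apply: le_trans (xle _ _ ji _) _; first lia.
  by case/predU1P: jP => // jE; move: ji im; rewrite jE; lia.
pose z i := if (i < j)%N then x i else if i == j then r else x i.-1.
(* The last term [1 / t_m] completes the Sylvester fractions to total 1, which is also the total
   [X m + r] of [z]. *)
pose s i : R := if (i < m)%N then (sylvester_y i)%:R^-1 else (sylvester_t m)%:R^-1.
have sumz l : \sum_(i < l) z i = if (l <= j)%N then X l else X l.-1 + r.
  exact: big_insert.
have sE l : (l <= m)%N -> \sum_(i < l) s i = 1 - (sylvester_t l)%:R^-1.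
  move=> lm; rewrite -sylvester_sumE; apply: eq_bigr => i _.
  by rewrite /s (leq_trans (ltn_ord i)).
have : \prod_(i < m.+1) s i <= \prod_(i < m.+1) z i.
  apply: prod_le_of_majorized.
  - move=> i im; rewrite /z; case: ltnP => _; first by apply: x0; lia.
    by case: eqP => // _; apply: x0; lia.
  - by move=> i _; rewrite /s; case: ifP; rewrite invr_ge0.
  - move=> i im; rewrite /z.
    case: (ltngtP i.+1 j) => [ij|ji|ij].
    + by apply: xdec; lia.
    + case: eqP => [->|ij] /=.
        by apply: jx; lia.
      by case: i im ji ij => [|i] ? ? ?; [lia|apply: xdec; lia].
    + by apply: xj; rewrite -ij.
  - move=> l lm; rewrite sumz sE //; case: leqP => jl; first exact: Xlt.
    case: l lm jl => // l lm _ /=.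
    (* Past [r] the prefix sum is [X l + r = 1 - (X m - X l)], so the tail needs a lower bound. It
       is at least [x m >= r / 2], hence at least a third of [1 - X l], hence by Curtiss at least
       [1 / (3 * t_l) >= 1 / t_(l+1)] once [t_l >= 2]. *)
    suff : (sylvester_t l.+1)%:R^-1 <= X m - X l by rewrite /r; lra.
    have := Xlt l (ltnW lm); have := t0 l; have := tE l.
    (* For [l = 0], where [t_0 = 1], the terms [x 0] and [x 1] give [X m >= 2 * x m >= r = 1 - X m],
       so [X m >= 1/2 = 1 / t_1]. *)
    case: l lm => [|l] lm.
      have -> : (sylvester_t 1)%:R = 2 :> R by [].
      rewrite /X big_ord0 subr0 => _ _ _.
      have : X 2 <= X m by apply: Xmon.
      rewrite /X !big_ord_recr big_ord0 /= add0r => X2.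
      have := xle 0 m isT (leqnSn m); have := xle 1%N m (ltnW m2) (leqnSn m).
      by move: rm; rewrite /r /X; lra.
    have := t0 l; have := tE l.
    set t := (sylvester_t l)%:R; set t1 := (sylvester_t l.+1)%:R.
    set t2 := (sylvester_t l.+2)%:R => t1E tge t2E t1ge X1.
    have t1ge2 : 2 <= t1 by rewrite t1E; nra.
    have : 3 * t2^-1 <= t1^-1.
      rewrite t2E invfM mulrA -[leRHS]mulr1 [3 * _]mulrC -mulrA ler_wpM2l //.
        by rewrite invr_ge0; lra.
      by rewrite ler_pdivrMr ?mul1r; lra.
    have : X l.+1 + x m <= X m.
      by apply: (@le_trans _ _ (X l.+2)); [apply: Xtail|apply: Xmon]; lia.
    by move: rm; rewrite /r; lra.
  - rewrite sumz leqNgt ltnS jm /= big_ord_recr /= sE // /s ltnn /r; lra.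
have -> : \prod_(i < m.+1) z i = \prod_(i < m) x i * r.
  by rewrite [LHS]big_insert leqNgt ltnS jm.
have -> : \prod_(i < m.+1) s i = (sylvester_t m)%:R ^- 2.
  rewrite big_ord_recr /= /s ltnn -exprVn expr2; congr (_ * _).
  rewrite -sylvester_prodE; apply: eq_bigr => i _.
  by rewrite ltn_ord.
move=> main; rewrite -(ler_nat R) natrM natrX natr_prod big_ord_recr /=.
have p0 : 0 < \prod_(i < m) ((a i)%:R : R).
  by apply: prodr_gt0 => i _; rewrite ltr0n; apply: a0; have := ltn_ord i; lia.
have am0 : 0 < (a m)%:R :> R by rewrite ltr0n a0.
have T0 : 0 < (sylvester_t m)%:R ^+ 2 :> R by rewrite exprn_gt0 // ltr0n sylvester_t_gt0.
move: main; rewrite /x prodfV.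
move: rm; rewrite /x => rm main.
have h : (a m)%:R * r <= 2 by rewrite -(divfK (lt0r_neq0 am0) 2) mulrC ler_pM2r.
move: main h; set p := \prod_(i < m) _; set T := _ ^+ 2; set A := (a m)%:R.
move=> pT Ar.
have {}pT : p <= T * r.
  have := ler_wpM2r (mulr_ge0 (ltW T0) (ltW p0)) pT.
  rewrite mulKf ?gt_eqF // (_ : p^-1 * r * (T * p) = T * r) //.
  by field; rewrite gt_eqF.
apply: (@le_trans _ _ (T * r * A)); first by rewrite ler_wpM2r // ltW.
by rewrite -mulrA [r * A]mulrC [2 * T]mulrC ler_wpM2l // ltW.
Qed.

End EgyptianFractions.

(** * Counting solutions from above *)

Lemma card_le_II_inj (T : Type) (A : set T) (f : T -> nat) (n : nat) :
  (forall x y, A x -> A y -> f x = f y -> x = y) ->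
  (forall x, A x -> (f x < n)%N) -> A #<= `I_n.
Proof.
move=> finj flt.
have fA : {in A &, injective f}.
  by move=> x y; rewrite !inE; apply: finj.
have := inj_card_eq fA; rewrite card_eq_le => /andP[_ /card_le_trans]; apply.
by apply: subset_card_le => _ [x Ax <-]; apply: flt.
Qed.

Lemma size_card_le (T : choiceType) (A : set T) (s : seq T) :
  uniq s -> (forall x, x \in s -> A x) -> `I_(size s) #<= A.
Proof.
case: s => [|x0 s] us sA; first by rewrite II0 card_ge0.
have finj : {in `I_(size (x0 :: s)) &, injective (nth x0 (x0 :: s))}.
  by move=> i j; rewrite !inE /= => i_s j_s /eqP; rewrite nth_uniq // => /eqP.
have := inj_card_eq finj; rewrite card_eq_le => /andP[_ /card_le_trans]; apply.
by apply: subset_card_le => _ [i i_s <-]; apply: sA; apply: mem_nth.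
Qed.

Lemma sorting_perm n (k : 'I_n -> nat) :
  exists s : {perm 'I_n}, forall i j : 'I_n, (i <= j)%N -> (k (s i) <= k (s j))%N.
Proof.
pose t := [tuple k i | i < n].
have /tuple_permP[p tp] : perm_eq (sort_tuple leq t) t by rewrite perm_sort.
exists p => i j ij.
have kp l : k (p l) = nth 0%N (sort leq t) l.
  have -> : sort leq t = sort_tuple leq t by [].
  by rewrite tp -tnth_nth !tnth_mktuple.
rewrite !kp; apply: (sorted_leq_nth leq_trans leqnn) => //.
- exact/sort_sorted/leq_total.
- by rewrite inE size_sort size_tuple.
- by rewrite inE size_sort size_tuple.
Qed.

Lemma card_family_ltn n m (k : 'I_n -> nat) :
  (forall j, (k j <= m)%N) ->
  #|family (fun j : 'I_n => [pred x : 'I_m | (x < k j)%N])| = (\prod_j k j)%N.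
Proof.
move=> km; rewrite card_family.
have cardE j : #|[pred x : 'I_m | (x < k j)%N]| = k j.
  rewrite -sum1_card -[RHS]card_ord -sum1_card (big_ord_widen m (fun=> 1%N)) //.
by rewrite foldrE big_image /=; apply: eq_bigr => j _; apply: cardE.
Qed.

(* A solution [b] of [\sum_i b i / k i = 1] is determined by the coordinates
   other than that of a maximal [k i], and these satisfy [b i < k i] unless
   [b] is concentrated on a single coordinate. *)
Lemma card_unit_fraction_solutions (R : realType) (d : nat) (T : Type)
    (k : 'I_d.+1 -> nat) (A : set T) (b : T -> 'I_d.+1 -> nat) :
  (3 <= d)%N -> (forall i, (0 < k i)%N) -> \sum_i ((k i)%:R : R)^-1 = 1 ->
  (forall x y, A x -> A y -> b x =1 b y -> x = y) ->
  (forall x, A x -> \sum_i ((b x i)%:R / (k i)%:R : R) = 1) ->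
  A #<= `I_(d + 2 * sylvester_t (d - 1) ^ 2).
Proof.
move=> d3 k0 ksum binj bsum.
have [s smon] := sorting_perm k.
(* [w] enumerates all indices except [s ord_max], where [k] is maximal. *)
pose w (j : 'I_d) := s (widen_ord (leqnSn d) j).
pose a i := k (s (inord i)).
have aw (j : 'I_d) : a j = k (w j).
  by rewrite /a /w; congr (k (s _)); apply: val_inj; rewrite /= inordK // ltnS ltnW.
have prodw : (\prod_j k (w j) <= 2 * sylvester_t (d - 1) ^ 2)%N.
  rewrite -(eq_bigr _ (fun j _ => aw j)).
  apply: (@prod_unit_fractions_le R) => //.
  - by move=> i _; apply: k0.
  - by move=> i id; rewrite /a; apply: smon; rewrite !inordK // ltnS // ltnW.
  - rewrite -[RHS]ksum [RHS](reindex_inj (@perm_inj _ s)).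
    by apply: eq_bigr => i _; rewrite /a inord_val.
have bsum_s x : A x -> \sum_j ((b x (s j))%:R / (k (s j))%:R : R) = 1.
  by move=> Ax; rewrite -[RHS](bsum _ Ax) [RHS](reindex_inj (@perm_inj _ s)).
have term0 x i : 0 <= (b x i)%:R / (k i)%:R :> R by rewrite divr_ge0.
have k0R i : 0 < (k i)%:R :> R by rewrite ltr0n.
have blek x i : A x -> (b x i <= k i)%N.
  move=> Ax; rewrite -(ler_nat R) -[leRHS]mul1r -ler_pdivrMr // -[leRHS](bsum _ Ax).
  by rewrite (bigD1 i) //= lerDl sumr_ge0.
(* A common strict bound for all coordinates [b x i <= k i], so that [inord] below never falls back
   to its default. *)
pose m := (\max_i k i).+1.
have km i : (k i < m)%N by rewrite ltnS leq_bigmax.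
pose g x : {ffun 'I_d -> 'I_m} := [ffun j => inord (b x (w j))].
have gE x j : A x -> g x j = b x (w j) :> nat.
  by move=> Ax; rewrite ffunE inordK // (leq_ltn_trans (blek _ _ Ax)) // km.
have ginj x y : A x -> A y -> g x = g y -> x = y.
  move=> Ax Ay gxy; apply: binj => // i.
  have bw j : b x (w j) = b y (w j) by rewrite -!gE // gxy.
  have [[j ->]|->] : (exists j, i = w j) \/ i = s ord_max.
  - rewrite -[i](permKV s); case: (unliftP ord_max ((s^-1)%g i)) => [j ->|->].
      by left; exists j; congr (s _); apply: val_inj; rewrite /= /bump leqNgt ltn_ord.
    by right.
  - exact: bw.
  have := etrans (bsum_s _ Ax) (esym (bsum_s _ Ay)); rewrite !big_ord_recr /=.
  rewrite (eq_bigr (fun j => (b y (w j))%:R / (k (w j))%:R)); last first.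
    by move=> j _; rewrite -/(w j) bw.
  move=> /addrI /(mulIf (invr_neq0 (lt0r_neq0 (k0R _)))) /eqP.
  by rewrite eqr_nat => /eqP.
pose S := family (fun j : 'I_d => [pred x : 'I_m | (x < k (w j))%N]).
pose e (j : 'I_d) : {ffun 'I_d -> 'I_m} :=
  [ffun i => if i == j then inord (k (w j)) else ord0].
have winj : injective w.
  by move=> i j /perm_inj /(congr1 val) /= ij; apply: val_inj.
have gS x : A x -> g x \in [seq e j | j <- enum 'I_d] ++ enum S.
  move=> Ax; rewrite mem_cat mem_enum.
  have [/forallP h|] := boolP [forall j, (b x (w j) < k (w j))%N].
    by apply/orP; right; apply/familyP => j; rewrite inE gE.
  move=> /forallPn /= [j]; rewrite -leqNgt => kb; apply/orP; left.
  have bE : b x (w j) = k (w j) by apply/eqP; rewrite eqn_leq blek.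
  apply/mapP; exists j; first by rewrite mem_enum.
  apply/ffunP => i; apply: val_inj; rewrite /= gE // ffunE.
  case: eqVneq => [->|ij]; first by rewrite inordK.
  (* The term at [w j] already equals 1, so every other term vanishes. *)
  have := bsum _ Ax; rewrite (bigD1 (w j)) //= bE divff ?gt_eqF //.
  rewrite (bigD1 (w i)) /=; last by apply: contra ij => /eqP/winj ->.
  rewrite -[X in _ = X -> _]addr0 => /addrI /eqP.
  rewrite paddr_eq0 ?sumr_ge0 // => /andP[+ _].
  by rewrite mulf_eq0 invr_eq0 !pnatr_eq0 (gtn_eqF (k0 _)) orbF => /eqP.
apply: (@card_le_II_inj _ _
    (fun x => index (g x) ([seq e j | j <- enum 'I_d] ++ enum S))).
  move=> x y Ax Ay /(congr1 (nth (g x) ([seq e j | j <- enum 'I_d] ++ enum S))).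
  by rewrite !nth_index ?gS // => /ginj; apply.
move=> x Ax; apply: (@leq_trans (size ([seq e j | j <- enum 'I_d] ++ enum S))).
  by rewrite index_mem gS.
rewrite size_cat size_map size_enum_ord -cardE.
by rewrite leq_add2l card_family_ltn // => j; apply: ltnW.
Qed.

(** * Counting solutions from below *)

Section SimplexPoints.
Context {R : archiRealFieldType}.

(** The lattice points [c >= 0] of the simplex [\sum_i c i / k i <= u], listed by slicing along the
    first coordinate. *)
Fixpoint simplex_points (k : seq nat) (u : R) : seq (seq nat) :=
  if k is m :: k' then
    [seq b :: c | b <- iota 0 (Num.truncn (m%:R * u)).+1,
                  c <- simplex_points k' (u - b%:R / m%:R)]
  else [:: [::]].

Implicit Types (k : seq nat) (u : R).

Lemma simplex_points_cons m k u : simplex_points (m :: k) u =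
  [seq b :: c | b <- iota 0 (Num.truncn (m%:R * u)).+1,
                c <- simplex_points k (u - b%:R / m%:R)].
Proof. by []. Qed.

Lemma simplex_points_uniq k u : uniq (simplex_points k u).
Proof.
elim: k u => // m k IH u; rewrite simplex_points_cons; apply: (@allpairs_uniq_dep _ (fun=> seq nat)) => //.
- exact: iota_uniq.
- by move=> [b c] [b' c'] _ _ /= [-> ->].
Qed.

Lemma simplex_points_step m u b : (0 < m)%N -> 0 <= u ->
  b \in iota 0 (Num.truncn (m%:R * u)).+1 -> 0 <= u - b%:R / m%:R.
Proof.
move=> m0 u0; rewrite mem_iota add0n ltnS => bu.
rewrite subr_ge0 ler_pdivrMr ?ltr0n // [u * _]mulrC.
apply: (@le_trans _ _ (Num.truncn (m%:R * u))%:R); first by rewrite ler_nat.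
by rewrite truncn_le mulr_ge0.
Qed.

Lemma simplex_pointsP k u c : all (fun m => 0 < m)%N k -> 0 <= u ->
  c \in simplex_points k u ->
  size c = size k /\
  \sum_(i < size k) ((nth 0%N c i)%:R / (nth 0%N k i)%:R : R) <= u.
Proof.
elim: k u c => [|m k IH] u c.
  by move=> _ u0; rewrite inE => /eqP ->; rewrite big_ord0.
rewrite simplex_points_cons => /andP[m0 k0] u0 /allpairsPdep[b [c' [bu c'u ->]]].
have [] := IH _ _ k0 (simplex_points_step m0 u0 bu) c'u.
move=> /= -> le_u; split=> //.
by rewrite big_ord_recl /= addrC -lerBrDr.
Qed.

(** Mean value bound: the derivative of [x ^+ n.+1] on [[w, v]] is at most [n.+1%:R * v ^+ n]. *)
Lemma subr_exp_le (n : nat) (v w : R) : 0 <= w -> w <= v ->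
  v ^+ n.+1 - w ^+ n.+1 <= n.+1%:R * v ^+ n * (v - w).
Proof.
move=> w0 wv; elim: n => [|n IH]; first by rewrite !expr1 expr0 !mul1r.
have v0 := le_trans w0 wv.
have := ler_wpM2l v0 IH; have : w ^+ n.+1 <= v ^+ n.+1 by rewrite lerXn2r.
move=> /(ler_wpM2r (_ : 0 <= v - w)); rewrite subr_ge0 => /(_ wv).
rewrite !exprS -[n.+2%:R]natr1; move: n.+1%:R => N; lra.
Qed.

(** The left side is the integral of [x ^+ n] over [[0, v]]; the right side is an upper Riemann sum
    with unit steps down from [v], the last step being cut off at 0. *)
Lemma sum_exp_ge (n N : nat) (v : R) : N%:R <= v -> v < N.+1%:R ->
  v ^+ n.+1 / n.+1%:R <= \sum_(b < N.+1) (v - b%:R) ^+ n.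
Proof.
elim: N v => [|N IH] v.
  move=> v0 v1; rewrite big_ord1 subr0 ler_pdivrMr ?ltr0n // exprSr.
  by rewrite ler_wpM2l ?exprn_ge0 // (le_trans (ltW v1)) // ler1n.
move=> Nv vN; rewrite big_ord_recl /= subr0.
have := IH (v - 1); rewrite lerBrDr ltrBlDr !natr1 => /(_ Nv vN).
have v1 : 1 <= v by rewrite (le_trans _ Nv) // ler1n.
have -> : \sum_(b < N.+1) (v - (bump 0 b)%:R) ^+ n =
    \sum_(b < N.+1) (v - 1 - b%:R) ^+ n.
  by apply: eq_bigr => b _; rewrite /bump leq0n natrD opprD addrA.
have : v ^+ n.+1 - (v - 1) ^+ n.+1 <= n.+1%:R * v ^+ n * (v - (v - 1)).
  by apply: subr_exp_le; lra.
rewrite subKr mulr1 lerBlDr => h1; set S := \sum_(_ < _) _ => h2.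
have n0 : 0 < n.+1%:R :> R by rewrite ltr0n.
move: h2; rewrite !ler_pdivrMr // mulrDl => h2.
by apply: le_trans h1 _; rewrite mulrC lerD2l.
Qed.

(* The count exceeds the volume of the simplex
   [\sum_i x i / k i <= u, x >= 0]. *)
Lemma size_simplex_points k u :
  k != [::] -> all (fun m => 0 < m)%N k -> 0 <= u ->
  (\prod_(m <- k) m)%:R * u ^+ size k / (size k)`!%:R
    < (size (simplex_points k u))%:R.
Proof.
case: k => // m k _; elim: k m u => [|m' k IH] m u.
  (* In dimension one the count is the integer part of [m * u] plus one, which exceeds [m * u];
     strictness originates here. *)
  move=> _ u0; rewrite simplex_points_cons size_allpairs_dep big_seq1 divr1 expr1.
  rewrite (eq_map (_ : _ =1 fun=> 1%N)) //.
  by rewrite sumnE big_map sum1_size size_iota truncnS_gt.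
set k' := m' :: k => /andP[m0 k0] u0.
have mR : 0 < m%:R :> R by rewrite ltr0n.
rewrite simplex_points_cons size_allpairs_dep sumnE big_map natr_sum.
set N := Num.truncn _; set n := size k'.
have n0 : 0 < n`!%:R :> R by rewrite ltr0n fact_gt0.
have /andP[Nle Nlt] : N%:R <= m%:R * u < N.+1%:R by rewrite truncn_itv ?mulr_ge0.
(* The slice at first coordinate [b] is a simplex of size [(m * u - b) / m]; summing the slice
   volumes leads to the Riemann sum of [sum_exp_ge]. *)
have pts b : b \in iota 0 N.+1 ->
    (\prod_(i <- k') i)%:R / n`!%:R / m%:R ^+ n * (m%:R * u - b%:R) ^+ n
    < (size (simplex_points k' (u - b%:R / m%:R)))%:R.
  move=> bN; apply: le_lt_trans (IH m' _ k0 (simplex_points_step m0 u0 bN)).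
  rewrite -/k' -/n.
  have -> : u - b%:R / m%:R = (m%:R * u - b%:R) / m%:R by field; rewrite gt_eqF.
  rewrite expr_div_n; set M := m%:R ^+ n; set V := (_ - _) ^+ n.
  have M0 : 0 < M by rewrite exprn_gt0.
  rewrite le_eqVlt; apply/orP; left; apply/eqP; field.
  by rewrite !gt_eqF.
apply: (@le_lt_trans _ _ (\sum_(b <- iota 0 N.+1)
    (\prod_(i <- k') i)%:R / n`!%:R / m%:R ^+ n * (m%:R * u - b%:R) ^+ n)).
  rewrite -mulr_sumr.
  have -> : \sum_(b <- iota 0 N.+1) (m%:R * u - b%:R) ^+ n =
      \sum_(b < N.+1) (m%:R * u - b%:R) ^+ n.
    by rewrite -[iota _ _]/(index_iota 0 N.+1) big_mkord.
  have := sum_exp_ge n Nle Nlt.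
  rewrite big_cons natrM exprMn (_ : size (m :: k') = n.+1) // factS natrM.
  set p := (\prod_(_ <- _) _)%:R; set S := \sum_(_ < _) _ => h.
  have c0 : 0 <= p / n`!%:R / m%:R ^+ n by rewrite !divr_ge0 ?exprn_ge0 ?ler0n.
  have := ler_wpM2l c0 h; apply: le_trans.
  rewrite le_eqVlt; apply/orP; left; apply/eqP.
  rewrite [m%:R ^+ n.+1]exprSr.
  have M0 : 0 < (m%:R : R) ^+ n by rewrite exprn_gt0.
  have K0 : 0 < n.+1%:R :> R by rewrite ltr0n.
  move: M0 K0 n0; move: (_ ^+ n) (_ ^+ n.+1) (n`!%:R) (n.+1%:R) => M U F K M0 K0 F0.
  by field; rewrite !gt_eqF.
rewrite big_seq [ltRHS]big_seq; apply: ltr_sum => [|b bN]; last exact: pts.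
by apply/hasP; exists 0%N; rewrite ?mem_iota.
Qed.
End SimplexPoints.

(** * Reflexive simplices and unit fractions *)

Section Pairing.
Context {R : realType} {d : nat}.
Implicit Types x y : 'rV[R]_d.

Lemma pairingC x y : pairing x y = pairing y x.
Proof. by apply: eq_bigr => i _; rewrite mulrC. Qed.

Lemma pairing_suml (I : Type) (r : seq I) (w : I -> R) (p : I -> 'rV[R]_d) y :
  pairing (\sum_(i <- r) w i *: p i) y = \sum_(i <- r) w i * pairing (p i) y.
Proof.
under [RHS]eq_bigr do rewrite mulr_sumr.
rewrite exchange_big; apply: eq_bigr => j _.
rewrite summxE mulr_suml; apply: eq_bigr => i _.
by rewrite !mxE mulrA.
Qed.

Lemma pairingZl a x y : pairing (a *: x) y = a * pairing x y.
Proof. by have := pairing_suml [:: tt] (fun=> a) (fun=> x) y; rewrite !big_seq1. Qed.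

Lemma pairingNl x y : pairing (- x) y = - pairing x y.
Proof. by rewrite -scaleN1r pairingZl mulN1r. Qed.

Lemma pairingDl x x' y : pairing (x + x') y = pairing x y + pairing x' y.
Proof. by rewrite -big_split; apply: eq_bigr => i _; rewrite mxE mulrDl. Qed.

Lemma pairingBl x x' y : pairing (x - x') y = pairing x y - pairing x' y.
Proof. by rewrite pairingDl pairingNl. Qed.

Lemma pairing0l y : pairing 0 y = 0.
Proof. by rewrite -(scale0r 0) pairingZl mul0r. Qed.

Lemma pairingE x y : pairing x y = (x *m y^T) 0 0.
Proof. by rewrite mxE; apply: eq_bigr => i _; rewrite mxE. Qed.

Lemma pairing_int x y : lattice x -> lattice y -> pairing x y \is a Num.int.
Proof. by move=> xi yi; apply: rpred_sum => i _; apply: rpredM. Qed.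

Lemma pairing_le x y : `|pairing x y| <= \sum_i `|x 0 i| * `|y 0 i|.
Proof.
by apply: le_trans (ler_norm_sum _ _ _) _; apply: ler_sum => i _; rewrite normrM.
Qed.

Lemma conv_mem (n : nat) (p : 'I_n -> 'rV[R]_d) (i : 'I_n) : Defs.conv p (p i).
Proof.
exists (fun j => (j == i)%:R); split=> [j||].
- by case: eqP.
- by rewrite (bigD1 i) //= eqxx big1 ?addr0 // => j /negPf ->.
- rewrite (bigD1 i) //= eqxx scale1r big1 ?addr0 // => j /negPf ->.
  by rewrite scale0r.
Qed.

(** If [x] differed from every [p i], the functional [u] would be strictly larger at each [p i] than
    at [x], although [x] is a weighted average of them. *)
Lemma vertex_conv (n : nat) (p : 'I_n -> 'rV[R]_d) x :
  is_vertex (Defs.conv p) x -> exists i, x = p i.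
Proof.
move=> [[w [w0 w1 xE]] [u umin]].
have [//|/forallNP npx] := pselect (exists i, x = p i).
have : \sum_i w i * (pairing (p i) u - pairing x u) = 0.
  under eq_bigr do rewrite mulrBr.
  by rewrite sumrB -pairing_suml -xE -mulr_suml w1 mul1r subrr.
have lt i : 0 < pairing (p i) u - pairing x u.
  rewrite subr_gt0; apply: umin; first exact: conv_mem.
  by move/esym; apply: npx.
move=> /eqP; rewrite psumr_eq0 => [/allP w_0|i _]; last first.
  by rewrite mulr_ge0 // ltW.
have : \sum_i w i = 0.
  apply: big1 => i _; have := w_0 i (mem_index_enum _).
  by rewrite mulf_eq0 (gt_eqF (lt i)) orbF => /eqP.
by rewrite w1 => /eqP; rewrite oner_eq0.
Qed.

End Pairing.

(** The vertices of a simplex around the origin and of its dual: [v j] lies on each facet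
    [pairing x (e i) = -1] with [i != j]. The [1 / k i] are the barycentric coordinates of the
    origin. *)
Definition dual_pair (R : realType) (d : nat) (k : 'I_d.+1 -> R)
    (v e : 'I_d.+1 -> 'rV[R]_d) : Prop :=
  (forall i, 0 < k i) /\
  forall i j, pairing (v j) (e i) = (if i == j then k i else 0) - 1.

Section DualPair.
Context {R : realType} {d : nat}.
Implicit Types (k : 'I_d.+1 -> R) (v e : 'I_d.+1 -> 'rV[R]_d).

Lemma dual_pair_sym k v e : dual_pair k v e -> dual_pair k e v.
Proof.
move=> [k0 ve]; split=> // i j; rewrite pairingC ve eq_sym.
by case: eqP => // ->.
Qed.

(* The matrices with rows [(1, v i)] and [(1, e i) / k i] are mutually inverse
   up to transposition. *)
Lemma dual_pair_barycentric k v e x : dual_pair k v e ->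
  \sum_i (1 + pairing x (e i)) / k i = 1 /\
  x = \sum_i ((1 + pairing x (e i)) / k i) *: v i.
Proof.
move=> [k0 ve].
pose V : 'M[R]_(d.+1, 1 + d) := \matrix_i row_mx 1 (v i).
pose U : 'M[R]_(1 + d, d.+1) := (\matrix_i ((k i)^-1 *: row_mx 1 (e i)))^T.
have rowE (y z : 'rV[R]_d) :
    ((row_mx 1 y : 'rV_(1 + d)) *m (row_mx 1 z)^T) 0 0 = 1 + pairing y z.
  by rewrite tr_row_mx mul_row_col pairingE mxE trmx1 mulmx1 [X in X + _]mxE eqxx.
have XU y i : ((row_mx 1 y : 'rV_(1 + d)) *m U) 0 i = (1 + pairing y (e i)) / k i.
  rewrite -rowE [LHS]mxE mxE mulr_suml; apply: eq_bigr => a _.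
  by rewrite !mxE [in RHS]mulrC mulrCA.
have VU : V *m U = 1%:M.
  apply/matrixP => i j.
  have -> : (V *m U) i j = (row i V *m U) 0 j.
    by rewrite [LHS]mxE [RHS]mxE; apply: eq_bigr => a _; rewrite !mxE.
  rewrite rowK XU ve addrC subrK !mxE eq_sym.
  by case: eqP => _; rewrite ?mul0r ?divff // gt_eqF.
have : (row_mx 1 x : 'rV_(1 + d)) = row_mx 1 x *m (U *m V).
  by rewrite (mulmx1C VU) mulmx1.
rewrite mulmxA mulmx_sum_row.
under eq_bigr do rewrite rowK XU scale_row_mx.
move=> E; split.
  have := congr1 lsubmx E; rewrite row_mxKl linear_sum /=.
  under eq_bigr do rewrite row_mxKl.
  move=> /matrixP/(_ 0 0); rewrite mxE eqxx summxE => E1.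
  by apply: etrans (esym E1); apply: eq_bigr => i _; rewrite !mxE eqxx mulr1.
have := congr1 rsubmx E; rewrite row_mxKr linear_sum /= => {1}->.
by apply: eq_bigr => i _; rewrite row_mxKr.
Qed.

(** The barycentric coordinates of [x] are [(1 + pairing x (e i)) / k i], so their signs are exactly
    the facet inequalities. *)
Lemma dual_pair_convP k v e : dual_pair k v e ->
  Defs.conv v = [set x | forall i, -1 <= pairing x (e i)].
Proof.
move=> kve; have [k0 ve] := kve; apply/seteqP; split=> x /=.
  move=> [w [w0 w1 ->]] i; rewrite pairing_suml.
  under eq_bigr do rewrite ve mulrBr mulr1.
  rewrite sumrB w1 lerBrDr addNr sumr_ge0 // => j _.
  by rewrite mulr_ge0 //; case: ifP => // _; apply: ltW.
move=> x_ge; have [s1 xE] := dual_pair_barycentric x kve.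
exists (fun i => (1 + pairing x (e i)) / k i); split=> // i.
by rewrite divr_ge0 ?(ltW (k0 i)) // -lerBlDl sub0r.
Qed.

Lemma dual_pair_dual k v e : dual_pair k v e ->
  dual_polytope (Defs.conv v) = Defs.conv e.
Proof.
move=> kve; rewrite (dual_pair_convP (dual_pair_sym kve)).
apply/seteqP; split=> x /= h.
  by move=> i; rewrite pairingC; apply/h/conv_mem.
move=> _ [w [w0 w1 ->]]; rewrite pairing_suml.
have -> : -1 = \sum_i w i * -1 by rewrite -mulr_suml w1 mul1r.
by apply: ler_sum => i _; rewrite ler_wpM2l // pairingC.
Qed.

Lemma dual_pair_vertex k v e i : dual_pair k v e ->
  is_vertex (Defs.conv v) (v i).
Proof.
move=> kve; have [k0 ve] := kve.
split; first exact: conv_mem.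
(* On the simplex [pairing x (e i) = k i * w i - 1], which is largest only for [w i = 1], that is at
   [v i]; the sign turns the maximum into a minimum. *)
exists (- e i) => x [w [w0 w1 xE]] x_v.
rewrite !(pairingC _ (- _)) !pairingNl ltrN2 !(pairingC (e i)) ve eqxx.
rewrite xE pairing_suml; under eq_bigr do rewrite ve mulrBr mulr1.
rewrite sumrB w1 ltrD2r (bigD1 i) //= eqxx big1 => [|j ji]; last first.
  by rewrite eq_sym (negPf ji) mulr0.
rewrite addr0 -[ltRHS]mul1r ltr_pM2r // lt_neqAle.
have wi1 : w i <= 1 by rewrite -w1 (bigD1 i) //= lerDl sumr_ge0.
rewrite wi1 andbT; apply/eqP => wi; apply: x_v.
have : \sum_(j | j != i) w j = 0.
  by move: w1; rewrite (bigD1 i) //= wi -[RHS]addr0 => /addrI.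
move=> /eqP; rewrite psumr_eq0 // => /allP w_0.
rewrite xE (bigD1 i) //= wi scale1r big1 ?addr0 // => j ji.
by have := w_0 j (mem_index_enum _); rewrite ji => /eqP ->; rewrite scale0r.
Qed.

Lemma dual_pair_affinely_independent k v e : dual_pair k v e ->
  affinely_independent v.
Proof.
move=> [k0 ve]; apply/row_freeP.
(* A right inverse of the edge matrix: an edge from [v ord0] pairs to [k j] with the [e j] of its
   own end point and to 0 with those of the other non-base vertices. *)
exists (\matrix_(a, j) (e (lift ord0 j) 0 a / k (lift ord0 j))).
apply/matrixP => i j; rewrite mxE.
have -> : \sum_a (\matrix_i (v (lift ord0 i) - v ord0)) i a *
      (\matrix_(a, j) (e (lift ord0 j) 0 a / k (lift ord0 j))) a j =
    pairing (v (lift ord0 i) - v ord0) (e (lift ord0 j)) / k (lift ord0 j).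
  by rewrite /pairing mulr_suml; apply: eq_bigr => a _; rewrite !mxE mulrA.
rewrite pairingBl !ve mxE (inj_eq lift_inj) [lift _ _ == ord0]eq_sym.
rewrite (negPf (neq_lift _ _)) sub0r opprK subrK [in RHS]eq_sym.
by case: eqP => _; rewrite ?mul0r ?divff // gt_eqF.
Qed.

Lemma dual_pair_interior k v e : dual_pair k v e -> interior (Defs.conv v) 0.
Proof.
move=> kve; rewrite (dual_pair_convP kve).
(* [M] bounds the l1 norm of each [e i], so sup norm below [M^-1] forces [|pairing x (e i)| <= 1];
   the summand 1 keeps [M] positive. *)
pose M := 1 + \sum_i \sum_a `|e i 0 a|.
have M0 : 0 < M by rewrite ltr_pwDl // sumr_ge0 // => i _; rewrite sumr_ge0.
apply/nbhs_ballP; exists M^-1 => /=; first by rewrite invr_gt0.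
move=> x /= [_ xM] i; suff: `|pairing x (e i)| <= 1 by rewrite ler_norml => /andP[].
apply: le_trans (pairing_le _ _) _.
apply: (@le_trans _ _ (\sum_a M^-1 * `|e i 0 a|)).
  apply: ler_sum => a _; rewrite ler_wpM2r //.
  by have := xM 0 a; rewrite /ball /= mxE sub0r normrN => /ltW.
rewrite -mulr_sumr mulrC ler_pdivrMr // mul1r /M (bigD1 i) //=.
rewrite addrCA lerDl addr_ge0 // sumr_ge0 // => j _; exact: sumr_ge0.
Qed.

Lemma dual_pair_reflexive k v e : dual_pair k v e ->
  (forall i, lattice (v i)) -> (forall i, lattice (e i)) ->
  reflexive_simplex (Defs.conv v).
Proof.
move=> kve vL eL; have vaff := dual_pair_affinely_independent kve.
split; last by exists d, v.
split.
- split; first by exists d.+1, v.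
  by move=> x /vertex_conv[i ->].
- split; first by exists v; split=> // i; apply: conv_mem.
  move=> p _ /eqP rk; have := rank_leq_col (\matrix_(i < d.+1) (p (lift ord0 i) - p ord0)).
  by rewrite rk ltnn.
- exact: dual_pair_interior kve.
- rewrite (dual_pair_dual kve); split; first by exists d.+1, e.
  by move=> x /vertex_conv[i ->].
Qed.

End DualPair.

Section ReflexiveSimplex.
Context {R : realType} {d : nat}.

(** Edge vectors of affinely independent points inside the simplex are combinations of its [n] edge
    vectors, so [d <= n]; the ambient space gives [n <= d]. *)
Lemma simplex_dim (n : nat) (p : 'I_n.+1 -> 'rV[R]_d) :
  affinely_independent p -> has_dim (Defs.conv p) d -> n = d.
Proof.
move=> paff [[q [q_p qaff]] _]; apply/eqP; rewrite eqn_leq; apply/andP; split.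
  by rewrite -(eqP paff) rank_leq_col.
rewrite -[leqLHS](eqP qaff).
have [w wP] := choice q_p.
pose C : 'M[R]_(d, n) := \matrix_(i, j) (w (lift ord0 i) (lift ord0 j) - w ord0 (lift ord0 j)).
rewrite (_ : \matrix_i _ = C *m \matrix_i (p (lift ord0 i) - p ord0)).
  exact: leq_trans (mxrankM_maxl _ _) (rank_leq_col _).
apply/row_matrixP => i; rewrite row_mul rowK mulmx_sum_row.
have [_ s1 ->] := wP (lift ord0 i); have [_ s0 ->] := wP ord0.
rewrite -sumrB; under eq_bigr do rewrite -scalerBl.
have -> : \sum_j (w (lift ord0 i) j - w ord0 j) *: p j =
    \sum_j (w (lift ord0 i) j - w ord0 j) *: (p j - p ord0).
  under [RHS]eq_bigr do rewrite scalerBr.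
  by rewrite sumrB -scaler_suml sumrB s1 s0 subrr scale0r subr0.
rewrite big_ord_recl subrr scaler0 add0r.
by apply: eq_bigr => j _; rewrite rowK !mxE.
Qed.

(** The barycentric coordinates are affine functions [c i + pairing x (g i)]. At the interior point
    0 they are positive, and dividing by [c i] gives [e i = g i / c i] and [k i = 1 / c i]. *)
Lemma simplex_dual_pair (p : 'I_d.+1 -> 'rV[R]_d) :
  affinely_independent p -> interior (Defs.conv p) 0 ->
  exists k e, dual_pair k p e.
Proof.
move=> paff p0.
pose A := \matrix_(i < d) (p (lift ord0 i) - p ord0).
have Au : A \in unitmx by rewrite -row_free_unit.
pose h (j : 'I_d) : 'rV[R]_d := (col j (invmx A))^T.
have Ah i j : pairing (p (lift ord0 i) - p ord0) (h j) = (i == j)%:R.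
  have := congr1 (fun B : 'M[R]_d => B i j) (mulmxV Au); rewrite !mxE => <-.
  by apply: eq_bigr => a _; rewrite !mxE.
pose g (i : 'I_d.+1) : 'rV[R]_d :=
  if unlift ord0 i is Some j then h j else - \sum_j h j.
pose c (i : 'I_d.+1) := (i == ord0)%:R - pairing (p ord0) (g i).
have cg i j : c i + pairing (p j) (g i) = (i == j)%:R.
  rewrite /c -addrA [- _ + _]addrC -pairingBl.
  have [j' ->|->] := unliftP ord0 j; last first.
    by rewrite subrr pairing0l addr0.
  rewrite /g; have [i' ->|->] := unliftP ord0 i.
    by rewrite Ah (inj_eq lift_inj) [lift _ _ == _]eq_sym (negPf (neq_lift _ _)) add0r eq_sym.
  rewrite pairingC pairingNl -[\sum_j h j](eq_bigr _ (fun j _ => scale1r (h j))).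
  rewrite pairing_suml (bigD1 j') //= pairingC Ah eqxx big1 => [|l lj].
    by rewrite addr0 mul1r subrr.
  by rewrite pairingC Ah eq_sym (negPf lj) mulr0.
have conv_ge x i : Defs.conv p x -> 0 <= c i + pairing x (g i).
  move=> [w [w0 w1 ->]]; rewrite pairing_suml -[c i]mul1r -w1 mulr_suml -big_split.
  by apply: sumr_ge0 => j _; rewrite /= -mulrDr cg mulr_ge0.
(* A small step from 0 away from [p i] stays in the simplex; its coordinate [c i - t * (1 - c i)] is
   nonnegative, so [c i * (1 + t) >= t > 0]. *)
have c0 i : 0 < c i.
  have /nbhs_ballP[e /= e0 eP] := p0.
  pose M := 1 + \sum_a `|p i 0 a|.
  have M0 : 0 < M by rewrite ltr_pwDl // sumr_ge0.
  have eM : 0 < e / M by rewrite divr_gt0.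
  have : Defs.conv p (- (e / M) *: p i).
    apply: eP; split=> // a b; rewrite /ball /= !mxE sub0r normrN normrM normrN.
    rewrite (gtr0_norm eM) mulrAC ltr_pdivrMr // ltr_pM2l // /M (ord1 a).
    by rewrite (bigD1 b) //= addrCA ltrDl ltr_pwDl // sumr_ge0.
  move=> /(conv_ge _ i); rewrite pairingZl.
  have := cg i i; rewrite eqxx -[true%:R]/1; move: eM; set t := e / M; set y := (pairing _ _).
  move=> t0 cy; have -> : y = 1 - c i by lra.
  move=> ct; rewrite -(pmulr_lgt0 _ (_ : 0 < 1 + t)); lra.
exists (fun i => (c i)^-1), (fun i => (c i)^-1 *: g i); split=> [i|i j].
  by rewrite invr_gt0.
rewrite pairingC pairingZl pairingC -[pairing _ _](addKr (c i)) cg mulrDr mulrN.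
by rewrite mulVf ?(gt_eqF (c0 i)) // addrC; case: eqP => _; rewrite ?mulr1 ?mulr0.
Qed.

(** Both vertex sets consist of lattice points, so [k i = pairing (v i) (e i) + 1] is an integer,
    and it is positive. *)
Lemma reflexive_simplex_dual_pair (P : set 'rV[R]_d) : reflexive_simplex P ->
  exists k v e, [/\ dual_pair (fun i => (k i)%:R) v e, P = Defs.conv v,
    forall i, lattice (v i), forall i, lattice (e i) & forall i, (0 < k i)%N].
Proof.
move=> [[[_ PL] Pdim P0 [_ DL]] [n [p [paff PE]]]]; subst P.
have nd := simplex_dim paff Pdim; subst n.
have [k [e ke]] := simplex_dual_pair paff P0.
have [k0 ve] := ke.
have vL i : lattice (p i) by apply: PL; apply: dual_pair_vertex ke.
have eL i : lattice (e i).
  apply: DL; rewrite (dual_pair_dual ke).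
  exact: dual_pair_vertex (dual_pair_sym ke).
have kN i : (Num.truncn (k i))%:R = k i.
  apply: truncnK; rewrite natrEint (ltW (k0 i)) andbT.
  have -> : k i = pairing (p i) (e i) + 1 by rewrite ve eqxx subrK.
  by apply: rpredD; [exact: pairing_int|exact: rpred1].
have kE : (fun i => (Num.truncn (k i))%:R) = k by apply/funext.
exists (fun i => Num.truncn (k i)), p, e; split=> //; first by rewrite kE.
by move=> i; rewrite -(ltr0n R) kN.
Qed.

Lemma card_lattice_points_reflexive_simplex (P : set 'rV[R]_d) :
  (3 <= d)%N -> reflexive_simplex P ->
  lattice_points P #<= `I_(d + 2 * sylvester_t (d - 1) ^ 2).
Proof.
move=> d3 /reflexive_simplex_dual_pair[k [v [e [ke PE vL eL k0]]]].
rewrite {}PE (dual_pair_convP ke).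
(* The lattice distances of [x] from the facets. They are natural numbers at the lattice points of
   the simplex, where truncation thus changes nothing. *)
pose b (x : 'rV[R]_d) i := Num.truncn (1 + pairing x (e i)).
have bE x i : (forall i, -1 <= pairing x (e i)) -> lattice x ->
    (b x i)%:R = 1 + pairing x (e i).
  move=> x_ge xL; apply: truncnK.
  rewrite natrEint -lerBlDl sub0r x_ge andbT.
  by apply: rpredD; [exact: rpred1|exact: pairing_int].
apply: (@card_unit_fraction_solutions R d _ k _ b) => //.
- have [+ _] := dual_pair_barycentric 0 ke.
  by under eq_bigr do rewrite pairing0l addr0 mul1r.
- move=> x y [x_ge xL] [y_ge yL] bxy.
  have [_ ->] := dual_pair_barycentric x ke.
  have [_ ->] := dual_pair_barycentric y ke.
  by apply: eq_bigr => i _; rewrite -!bE // bxy.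
- move=> x [x_ge xL]; have [+ _] := dual_pair_barycentric x ke.
  by under eq_bigr do rewrite -bE //.
Qed.

End ReflexiveSimplex.

(** * A reflexive simplex with many lattice points *)

Section EgyptianSimplex.
Context {R : realType} {d : nat}.
Context (k : 'I_d.+1 -> nat).
Context (k_gt0 : forall i, (0 < k i)%N).
Context (k_dvd : forall i, (k i %| k ord0)%N).
Context (k_sum : \sum_i ((k i)%:R : R)^-1 = 1).

(** The corner simplex spanned by 0 and the multiples [k i] of the unit vectors, translated by
    [(-1, .., -1)]; index [ord0] is the corner. *)
Definition simplex_vertex (i : 'I_d.+1) : 'rV[R]_d :=
  \row_a ((lift ord0 a == i)%:R * (k i)%:R - 1).

(** Index [ord0] belongs to the oblique facet; its entries are integers because every [k i] divides
    [k ord0]. *)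
Definition simplex_normal (i : 'I_d.+1) : 'rV[R]_d :=
  \row_a (if i == ord0 then - ((k ord0)%:R / (k (lift ord0 a))%:R)
          else (lift ord0 a == i)%:R).

Lemma pairing_normal_lift (x : 'rV[R]_d) j :
  pairing x (simplex_normal (lift ord0 j)) = x 0 j.
Proof.
rewrite /pairing (bigD1 j) //= mxE eq_sym (negPf (neq_lift _ _)) eqxx mulr1.
rewrite big1 ?addr0 // => a aj.
by rewrite mxE eq_sym (negPf (neq_lift _ _)) (inj_eq lift_inj) (negPf aj) mulr0.
Qed.

Lemma pairing_normal0 (b : 'I_d -> R) :
  pairing (\row_a (b a - 1)) (simplex_normal ord0) =
  (k ord0)%:R * (1 - \sum_a b a / (k (lift ord0 a))%:R) - 1.
Proof.
have K0 : (k ord0)%:R != 0 :> R by rewrite pnatr_eq0 -lt0n.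
move: k_sum; rewrite big_ord_recl => /eqP; rewrite addrC eq_sym -subr_eq => /eqP s.
transitivity (- (k ord0)%:R * (\sum_a b a / (k (lift ord0 a))%:R
    - \sum_a ((k (lift ord0 a))%:R : R)^-1)).
  rewrite -sumrB mulr_sumr; apply: eq_bigr => a _; rewrite !mxE eqxx; ring.
by rewrite -s; field.
Qed.

Lemma egyptian_simplex_dual_pair :
  dual_pair (fun i => (k i)%:R) simplex_vertex simplex_normal.
Proof.
split=> [i|i j]; first by rewrite ltr0n.
have [i' ->|->] := unliftP ord0 i.
  rewrite pairing_normal_lift mxE.
  by case: eqP => [->|_]; rewrite ?mul1r ?mul0r.
rewrite pairing_normal0; congr (_ - 1).
have [j' ->|->] := unliftP ord0 j; last first.
  rewrite eqxx big1 ?subr0 ?mulr1 // => a _.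
  by rewrite eq_sym (negPf (neq_lift _ _)) !mul0r.
rewrite (negPf (neq_lift _ _)) (bigD1 j') //= eqxx mul1r divff; last first.
  by rewrite pnatr_eq0 -lt0n.
rewrite big1 ?addr0 ?subrr ?mulr0 // => a aj.
by rewrite (inj_eq lift_inj) (negPf aj) !mul0r.
Qed.

Lemma egyptian_simplex_reflexive :
  reflexive_simplex (Defs.conv simplex_vertex).
Proof.
apply: dual_pair_reflexive egyptian_simplex_dual_pair _ _ => i a; rewrite mxE.
  by rewrite rpredB ?rpredM ?rpred1 ?natr_int.
case: ifP => _; last by rewrite natr_int.
have /dvdnP[q ->] := k_dvd (lift ord0 a).
by rewrite natrM mulfK ?rpredN ?natr_int // pnatr_eq0 -lt0n.
Qed.

Lemma egyptian_simplex_lattice_point (b : 'I_d -> nat) :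
  \sum_a ((b a)%:R / (k (lift ord0 a))%:R : R) <= 1 ->
  lattice_points (Defs.conv simplex_vertex) (\row_a ((b a)%:R - 1)).
Proof.
move=> b1; split; last first.
  by move=> a; rewrite mxE rpredB ?rpred1 ?natr_int.
rewrite (dual_pair_convP egyptian_simplex_dual_pair) => i /=.
have [j ->|->] := unliftP ord0 i.
  by rewrite pairing_normal_lift mxE lerBrDr addNr.
by rewrite pairing_normal0 lerBrDr addNr mulr_ge0 // subr_ge0.
Qed.

End EgyptianSimplex.

Lemma sylvester_tE n : sylvester_t n = (\prod_(i < n) sylvester_y i)%N.
Proof. by rewrite /sylvester_t sylvester_yE addKn. Qed.

Lemma exists_large_reflexive_simplex (R : realType) (d : nat) : (3 <= d)%N ->
  exists (P : set 'rV[R]_d) (n : nat),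
    [/\ reflexive_simplex P, `I_n #<= lattice_points P
      & 1 / (3 * ((d - 2)`!)%:R) * (sylvester_t (d - 1))%:R ^+ 2 < n%:R :> R].
Proof.
case: d => [|[|[|n]]] // _; rewrite subn1 subn2 /=.
set T := sylvester_t n.+2.
(* With [d = n.+3] and [T = t_(d-1)], the fractions sum to [(1 - 1/T) + 2 / (2 * T) = 1]. One copy
   of [2 * T] goes to index [ord0], since each [y_i] divides [T]. *)
pose kk j := if (j < n.+2)%N then sylvester_y j else (2 * T)%N.
pose k (i : 'I_n.+4) := if i == 0%N :> nat then (2 * T)%N else kk i.-1.
have T0 : (0 < T)%N by apply: sylvester_t_gt0.
have kk0 j : (0 < kk j)%N.
  by rewrite /kk; case: ifP => _; rewrite ?sylvester_yT ?muln_gt0.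
have k0 i : (0 < k i)%N by rewrite /k; case: ifP => _; rewrite ?muln_gt0.
have kdvd i : (k i %| k ord0)%N.
  rewrite /k /=; case: ifP => // _; rewrite /kk; case: ltnP => // im.
  by rewrite dvdn_mull // /T sylvester_tE (bigD1 (Ordinal im)) //= dvdn_mulr.
have ksum : \sum_i ((k i)%:R : R)^-1 = 1.
  rewrite big_ord_recl /= big_ord_recr /= /k /= /kk ltnn.
  rewrite (eq_bigr (fun i : 'I_n.+2 => (sylvester_y i)%:R^-1)).
    rewrite sylvester_sumE -/T natrM.
    have : T%:R != 0 :> R by rewrite pnatr_eq0 -lt0n.
    by move=> ?; field.
  by move=> i _; rewrite /bump /= ltn_ord.
(* The [d - 2] coordinates left free once those at [y_0 = 2] and [y_1 = 3] are set to 0. *)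
pose ks := mkseq (fun i => kk i.+2) n.+1.
have ks0 : all (fun m => 0 < m)%N ks by apply/allP => _ /mapP[i _ ->].
pose row c : 'rV[R]_n.+3 := \row_a ((nth 0%N [:: 0%N, 0%N & c] a)%:R - 1).
pose L := [seq row c | c <- simplex_points ks (1 : R)].
exists (Defs.conv (simplex_vertex k)), (size L); split.
- exact: egyptian_simplex_reflexive.
- apply: size_card_le.
    rewrite map_inj_in_uniq ?simplex_points_uniq //.
    move=> c c' /(simplex_pointsP ks0 ler01)[sc _] /(simplex_pointsP ks0 ler01)[sc' _].
    move=> /rowP row_eq; apply: (@eq_from_nth _ 0%N); first by rewrite sc sc'.
    move=> i; rewrite sc size_mkseq => i_n.
    have := row_eq (lift ord0 (lift ord0 (Ordinal i_n))).
    by rewrite !mxE => /addIr/eqP; rewrite eqr_nat => /eqP.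
  move=> _ /mapP[c /(simplex_pointsP ks0 ler01)[sc c1] ->].
  apply: (egyptian_simplex_lattice_point k0 ksum).
  rewrite 2!big_ord_recl /= !mul0r !add0r.
  apply: le_trans c1; rewrite size_mkseq le_eqVlt; apply/orP; left; apply/eqP.
  by apply: eq_bigr => i _; rewrite nth_mkseq.
- rewrite size_map; apply: le_lt_trans (size_simplex_points _ ks0 ler01) => //.
  rewrite size_mkseq expr1n mulr1 big_map -[iota _ _]/(index_iota 0 n.+1) big_mkord.
  (* [T = 2 * 3 * y_2 * .. * y_(d-2)], so the product of [ks] is [(T / 6) * (2 * T) = T ^ 2 / 3]. *)
  have -> : (T%:R ^+ 2 : R) = 3 * (\prod_(i < n.+1) kk i.+2)%:R.
    rewrite -natrX -natrM; congr _%:R.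
    rewrite big_ord_recr /= /kk ltnn /=.
    rewrite (eq_bigr (fun i : 'I_n => sylvester_y i.+2)); last first.
      by move=> i _; rewrite !ltnS ltn_ord.
    rewrite {1 2}/T expnS expn1 {1}sylvester_tE 2!big_ord_recl /=.
    rewrite (_ : sylvester_y 0 = 2%N) // (_ : sylvester_y (bump 0 0) = 3%N) //.
    by rewrite -/T; set p := (\prod_(i < n) _)%N; ring.
  have F0 : (n.+1)`!%:R != 0 :> R by rewrite pnatr_eq0 -lt0n fact_gt0.
  by rewrite le_eqVlt; apply/orP; left; apply/eqP; field.
Qed.

(** * The Vardi constant *)

Section Vardi.
Context {R : realType}.

Definition root2 (n : nat) (x : R) := iter n Num.sqrt x.

Lemma root2_ge0 n x : 0 <= x -> 0 <= root2 n x.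
Proof. by case: n => [|n] //= _; apply: sqrtr_ge0. Qed.

Lemma root2K n x : 0 <= x -> root2 n x ^+ (2 ^ n) = x.
Proof.
elim: n => [|n IH] x0; first by rewrite expr1.
by rewrite expnS exprM sqr_sqrtr ?IH // root2_ge0.
Qed.

Lemma ler_root2 n x y : 0 <= x -> x <= y -> root2 n x <= root2 n y.
Proof.
by move=> x0 xy; elim: n => // n IH /=; rewrite ler_sqrt // (root2_ge0 _ (le_trans x0 xy)).
Qed.

Lemma root2SE n x : 0 <= x -> root2 n.+1 (x ^+ 2) = root2 n x.
Proof. by move=> x0; rewrite /root2 iterSr sqrtr_sqr ger0_norm. Qed.

Lemma sylvester_yS n :
  (sylvester_y n.+1)%:R = (sylvester_y n)%:R ^+ 2 - (sylvester_y n)%:R + 1 :> R.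
Proof.
rewrite !sylvester_yT sylvester_tS -!natr1 natrM -!natr1; ring.
Qed.

(** The floor condition at [n] says [y_n - 1/2 <= c ^+ (2 ^ n.+1) < y_n + 1/2]; taking roots
    confines [c] to an interval with these ends, and the intervals are nested. *)
Definition vardi_lower n := root2 n.+1 ((sylvester_y n)%:R - 1 / 2).
Definition vardi_upper n := root2 n.+1 ((sylvester_y n)%:R + 1 / 2).

Lemma sylvester_y_ge2 n : 2 <= (sylvester_y n)%:R :> R.
Proof. by rewrite ler_nat sylvester_yT ltnS sylvester_t_gt0. Qed.

(** [(y_n - 1/2)^2 = y_n^2 - y_n + 1/4], just below [y_(n+1) - 1/2 = y_n^2 - y_n + 1/2]. *)
Lemma vardi_lowerS n : vardi_lower n <= vardi_lower n.+1.
Proof.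
have y2 := sylvester_y_ge2 n.
rewrite /vardi_lower -[X in X <= _]root2SE; last by lra.
by apply: ler_root2; rewrite ?sqr_ge0 // sylvester_yS; nra.
Qed.

Lemma vardi_upperS n : vardi_upper n.+1 <= vardi_upper n.
Proof.
have y2 := sylvester_y_ge2 n.
rewrite /vardi_upper -[X in _ <= X]root2SE; last by lra.
by apply: ler_root2; rewrite sylvester_yS; nra.
Qed.

Lemma vardi_lower_upper n m : vardi_lower n <= vardi_upper m.
Proof.
have y2 l := sylvester_y_ge2 l.
apply: (@le_trans _ _ (vardi_lower (maxn n m))).
  elim: (maxn n m) (leq_maxl n m) => [|l IH]; first by rewrite leqn0 => /eqP ->.
  rewrite leq_eqVlt => /predU1P[->//|/IH h].
  exact: le_trans h (vardi_lowerS _).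
apply: (@le_trans _ _ (vardi_upper (maxn n m))).
  by apply: ler_root2; have := y2 (maxn n m); lra.
elim: (maxn n m) (leq_maxr n m) => [|l IH]; first by rewrite leqn0 => /eqP ->.
rewrite leq_eqVlt => /predU1P[->//|/IH h].
exact: le_trans (vardi_upperS _) h.
Qed.

Lemma exists_Vardi_constant : exists c : R, is_Vardi_constant c.
Proof.
pose c := sup (range vardi_lower).
have lower_c n : vardi_lower n <= c.
  apply: ub_le_sup; last by exists n.
  by exists (vardi_upper 0) => _ [m _ <-]; apply: vardi_lower_upper.
have c_upper n : c <= vardi_upper n.
  apply: ge_sup; first by exists (vardi_lower 0), 0%N.
  by move=> _ [m _ <-]; apply: vardi_lower_upper.
have low0 n : 0 <= vardi_lower n.
  by apply: root2_ge0; have := sylvester_y_ge2 n; lra.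
have c_ge0 := le_trans (low0 0%N) (lower_c 0%N).
have c_ge n : (sylvester_y n)%:R - 1 / 2 <= c ^+ (2 ^ n.+1).
  have y2 := sylvester_y_ge2 n.
  rewrite -[leLHS](@root2K n.+1); last by lra.
  by apply: lerXn2r; rewrite ?nnegrE //; [exact: low0|exact: lower_c].
have c_le n : c ^+ (2 ^ n.+1) <= (sylvester_y n)%:R + 1 / 2.
  have y2 := sylvester_y_ge2 n.
  rewrite -[leRHS](@root2K n.+1); last by lra.
  apply: lerXn2r; rewrite ?nnegrE //; last exact: c_upper.
  by apply: root2_ge0; lra.
exists c; split.
  rewrite lt_neqAle c_ge0 andbT eq_sym; apply/eqP => c0.
  have := c_ge 0%N; rewrite c0 expr0n /=; have := sylvester_y_ge2 0; lra.
move=> n; apply/esym/floor_def.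
have y2 := sylvester_y_ge2 n.
(* Strictness comes from the next index: the square of the left side is at most
   [y_(n+1) + 1/2 < (y_n + 1/2)^2]. *)
have lt : c ^+ (2 ^ n.+1) < (sylvester_y n)%:R + 1 / 2.
  have := c_le n.+1; rewrite expnSr exprM sylvester_yS.
  have : 0 <= c ^+ (2 ^ n.+1) by rewrite exprn_ge0.
  by set C := c ^+ _; nra.
rewrite intrD -pmulrn; have := c_ge n; lra.
Qed.

Lemma sylvester_bigO (c : R) : is_Vardi_constant c ->
  (fun d : nat => (d + 2 * sylvester_t (d - 1) ^ 2)%:R : R)
    =O_\oo (fun d : nat => c ^+ (2 ^ (d + 1))).
Proof.
(* The constant 3: with [t = t_(d-1)], [d <= t] gives [d + 2 * t^2 <= 3 * t^2], and
   [t <= c ^+ (2 ^ d)]. *)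
move=> [c0 cy]; apply/eqOP; exists 3; split; first by rewrite num_real.
move=> K K3; near=> d.
have d0 : (0 < d)%N by near: d; exists 1%N.
have c_ge0 := ltW c0.
rewrite !ger0_norm ?exprn_ge0 //.
have tc : (sylvester_t (d - 1))%:R <= c ^+ (2 ^ d) :> R.
  have := ge_floor (c ^+ (2 ^ (d - 1).+1) + 1 / 2).
  rewrite -cy subn1 prednK // sylvester_yT -pmulrn -[(sylvester_t _).+1%:R]natr1; lra.
have td : (d <= sylvester_t (d - 1))%N.
  by have := sylvester_t_ge (d - 1); rewrite subn1 prednK.
apply: (@le_trans _ _ (3 * c ^+ (2 ^ (d + 1)))); last first.
  by rewrite ler_wpM2r ?exprn_ge0 // ltW.
apply: (@le_trans _ _ (3 * (sylvester_t (d - 1))%:R ^+ 2)).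
  rewrite -natrX -natrM ler_nat; nia.
rewrite ler_pM2l // addn1 expnSr exprM lerXn2r ?nnegrE ?exprn_ge0.
Unshelve. all: by end_near.
Qed.
End Vardi.

(** * The maximal number of lattice points and its bounds *)

Theorem corollary1p6 (R : realType) :
  (forall d : nat, (3 <= d)%N ->
     exists J : nat,
       [/\ is_max_lattice_points R d J,
           1 / (3 * ((d - 2)`!)%:R) * (sylvester_t (d - 1))%:R ^+ 2
             < J%:R :> R
         & (J <= d + 2 * sylvester_t (d - 1) ^ 2)%N]) /\
  (exists2 c : R, is_Vardi_constant c &
     (fun d : nat => (d + 2 * sylvester_t (d - 1) ^ 2)%:R : R)
       =O_\oo (fun d : nat => c ^+ (2 ^ (d + 1)))).
Proof.
split=> [d d3|]; last first.
  have [c cV] := exists_Vardi_constant (R := R).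
  by exists c => //; apply: sylvester_bigO.
(* The set of lattice point counts is nonempty by the constructed simplex and bounded by the upper
   estimate, so it has a maximum [J]. *)
pose attained n := `[< exists2 P : set 'rV[R]_d,
  reflexive_simplex P & (lattice_points P #= `I_n)%card >].
have cardP (P : set 'rV[R]_d) : reflexive_simplex P ->
    exists2 n, (lattice_points P #= `I_n)%card & attained n.
  move=> Prefl; have LP := card_lattice_points_reflexive_simplex d3 Prefl.
  have /finite_setP[n Pn] := card_le_finite LP (finite_II _).
  by exists n => //; apply/asboolP; exists P.
have attained_le n : attained n -> (n <= d + 2 * sylvester_t (d - 1) ^ 2)%N.
  move=> /asboolP[P Prefl Pn]; rewrite -card_le_II -(card_le_eql Pn).
  exact: card_lattice_points_reflexive_simplex.
have [P [n0 [Prefl Pn0 n0_gt]]] := exists_large_reflexive_simplex R d3.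
have [n1 Pn1 att1] := cardP _ Prefl.
have [J attJ Jmax] := ex_maxnP (ex_intro _ n1 att1) attained_le.
exists J; split; last exact: attained_le.
- split; first exact/asboolP.
  by move=> Q /cardP[n Qn /Jmax nJ]; rewrite (card_le_eql Qn) card_le_II.
- apply: lt_le_trans n0_gt _; rewrite ler_nat.
  by apply: leq_trans (Jmax _ att1); rewrite -card_le_II -(card_le_eqr Pn1).
Qed.
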